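(* Let $\mu,\nu\in\mathcal P_2(\mathbb R^n)$ and let $\pi\in\Pi(\mu,\nu)$ be an arbitrary coupling. Let $(X_t,Y_t)$ be the solution of the orthogonal coupling dynamics (OCD) $$\dot X_t=-\nabla_xc(X_t,Y_t)+\mathbb E_{p_t}[\nabla_xc(X_t,Y_t)\mid X_t],\qquad \dot Y_t=-\nabla_yc(X_t,Y_t)+\mathbb E_{p_t}[\nabla_yc(X_t,Y_t)\mid Y_t],$$ with initial condition $(X_0,Y_0)\sim\pi$, where $p_t$ is the joint law of $(X_t,Y_t)$. Suppose that at some time $T>0$ the law is sub-optimal, i.e. $p_T\in\Pi^*(\mu,\nu)$, and that the Regularity Assumption (stated in the context) holds. Then $p_T$ is unstable in the following sense: if, for some $0<\epsilon<1$, the law at time $T$ is perturbed to $$p_T^\epsilon=(1-\epsilon)\,p_T+\epsilon\,\pi^{\mathrm{opt}}_{\mu,\nu},$$ then the solution of the OCD continued from the law $p_T^\epsilon$ at time $T$ does not have law $p_T$ at any later time $t>T$.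
   Context: Notation. $\mathcal P_2(\mathbb R^m)$ is the set of Borel probability measures on $\mathbb R^m$ with finite second moment; $\Pi(\mu,\nu)$ is the set of joint measures in $\mathcal P_2(\mathbb R^n\times\mathbb R^n)$ with marginals $\mu,\nu\in\mathcal P_2(\mathbb R^n)$. $c:\mathbb R^{2n}\to\mathbb R$ is a non-negative smooth cost function. $\pi^{\mathrm{opt}}_{\mu,\nu}$ (also written $\pi^{\mathrm{opt}}$) is a minimizer of $\int c\,d\pi$ over $\pi\in\Pi(\mu,\nu)$ (solution of the Monge–Kantorovich problem). The set of sub-optimal couplings is $$\Pi^*(\mu,\nu)=\Big\{\pi\in\Pi(\mu,\nu):\int_{\mathbb R^{2n}}c(x,y)\,\pi(dx,dy)>\int_{\mathbb R^{2n}}c(x,y)\,\pi^{\mathrm{opt}}(dx,dy)\Big\}.$$ $X_t,Y_t$ are $\mathbb R^n$-valued square-integrable random variables on a common probability space. Regularity Assumption (imposed on the solutions of the dynamics under consideration). For each $t$ the joint law $p_t$ of $(X_t,Y_t)$ admits a Lebesgue density $\rho_t\in L^1(\mathbb R^{2n})$ with finite second moment. Moreover: (1) $t\mapsto\rho_t$ is weakly continuous in $L^1$. (2) The velocity field $v_t=(v_{1,t},v_{2,t})$ (the right-hand side of the dynamics, as a function of $(x,y)$) satisfies $v_t\in L^2(p_t)$ and $v_t\rho_t\in L^1(\mathbb R^{2n})$. (3) $c\in C^1(\mathbb R^{2n})$ and $|\nabla_xc(x,y)|+|\nabla_yc(x,y)|\le C(1+|x|+|y|)$ for some constant $C$. (4)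 Conditional expectations such as $\mathbb E_{p_t}[\nabla_xc(X_t,Y_t)\mid X_t=x]$ exist in $L^2(\mu)$ and define measurable functions (and likewise for $y$ with $L^2(\nu)$). (5) There is $L>0$ such that for all $p,q\in\Pi(\mu,\nu)$, $\|\mathbb E_p[\nabla_xc(X,Y)\mid X]-\mathbb E_q[\nabla_xc(X,Y)\mid X]\|_{L^2(\mu)}\le L\,W_2(p,q)$, where $W_2$ is the 2-Wasserstein distance, and similarly for the conditional expectation with respect to $Y$. *)

(* Defs.v *)
From HB Require Import structures.
From mathcomp Require Import all_boot all_order all_algebra.
From mathcomp Require Import all_classical all_reals all_analysis.

Set Implicit Arguments.
Unset Strict Implicit.
Unset Printing Implicit Defensive.

Import Order.TTheory GRing.Theory Num.Theory.
Import numFieldNormedType.Exports.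

Local Open Scope classical_set_scope.
Local Open Scope ring_scope.

(* ['rV[R]_n] carries the sigma-algebra generated by the coordinates, which is
   the Borel sigma-algebra of R^n; R^2n is represented by the product
   ['rV[R]_n * 'rV[R]_n] of a block x and a block y. *)
Definition measure_rV_display : measure_display.
Proof. exact: default_measure_display. Qed.

Section measurable_rV.
Context (R : realType) (n : nat).

Definition coor_rV (i : 'I_n) (x : 'rV[R]_n) : R := x ord0 i.

Let rV_set0 : g_sigma_preimage coor_rV set0.
Proof. exact: sigma_algebra0. Qed.

Let rV_setC A : g_sigma_preimage coor_rV A -> g_sigma_preimage coor_rV (~` A).
Proof. exact: sigma_algebraC. Qed.

Let rV_bigcup (F : (set 'rV[R]_n)^nat) :
  (forall i, g_sigma_preimage coor_rV (F i)) ->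
  g_sigma_preimage coor_rV (\bigcup_i F i).
Proof. exact: sigma_algebra_bigcup. Qed.

HB.instance Definition _ := @isMeasurable.Build measure_rV_display
  'rV[R]_n (g_sigma_preimage coor_rV) rV_set0 rV_setC rV_bigcup.

Lemma measurable_coor (i : 'I_n) : measurable_fun [set: 'rV[R]_n] (coor_rV i).
Proof.
move=> _ Y mY; rewrite setTI; apply: sub_sigma_algebra => /=.
rewrite -bigcup_seq/=; exists i => /=; first by rewrite mem_index_enum.
by exists Y => //; rewrite setTI.
Qed.

Lemma measurable_fun_rV d (T : measurableType d) (f : T -> 'rV[R]_n) :
  (forall i, measurable_fun [set: T] (coor_rV i \o f)) ->
  measurable_fun [set: T] f.
Proof.
move=> mf; apply: (@measurability _ _ _ _ _ _
  (\big[setU/set0]_(i < n) preimage_set_system setT (coor_rV i) measurable)) => //.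
move=> B [C]; rewrite -bigcup_seq => -[i /= _ [Y mY <-]] <-.
rewrite setTI (setTI (_ @^-1` _)) -comp_preimage -[X in measurable X]setTI.
exact: mf.
Qed.

End measurable_rV.

Section image_measure.
Context d1 d2 (T1 : measurableType d1) (T2 : measurableType d2) (R : realType).
Variables (m : {measure set T1 -> \bar R}) (f : {mfun T1 >-> T2}).

Definition image_measure : set T2 -> \bar R := pushforward m f.

Let image_measure0 : image_measure set0 = 0%E.
Proof. exact: measure0. Qed.

Let image_measure_ge0 A : (0 <= image_measure A)%E.
Proof. exact: measure_ge0. Qed.

Let image_measure_sigma_additive : semi_sigma_additive image_measure.
Proof. exact: measure_semi_sigma_additive. Qed.

HB.instance Definition _ := isMeasure.Build _ _ _ image_measure
  image_measure0 image_measure_ge0 image_measure_sigma_additive.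

End image_measure.

Section lebesgue_rV.
Context (R : realType).

Definition cons_rV n (z : 'rV[R]_n * measurableTypeR R) : 'rV[R]_n.+1 :=
  \row_(i < n.+1) oapp (z.1 ord0) z.2 (unlift ord0 i).

Lemma measurable_cons_rV n : measurable_fun setT (@cons_rV n).
Proof.
apply: measurable_fun_rV => i; rewrite /comp /coor_rV /cons_rV.
under eq_fun do rewrite mxE.
case: (unlift ord0 i) => [j|] /=; last exact: measurable_snd.
exact: (measurableT_comp (@measurable_coor R n j) measurable_fst).
Qed.

HB.instance Definition _ n :=
  @isMeasurableFun.Build _ _ _ _ (@cons_rV n) (@measurable_cons_rV n).

(* Lebesgue measure on R^n is obtained by adding one coordinate at a time. *)
Fixpoint lebesgue_rV n : {measure set 'rV[R]_n -> \bar R} :=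
  if n is m.+1 return {measure set 'rV[R]_n -> \bar R} then
    image_measure (lebesgue_rV m \x lebesgue_measure)%E (@cons_rV m)
  else dirac (0 : 'rV[R]_0).

Definition split_rV n (v : 'rV[R]_(n + n)) : 'rV[R]_n * 'rV[R]_n :=
  (lsubmx v, rsubmx v).

Lemma measurable_split_rV n : measurable_fun setT (@split_rV n).
Proof.
apply/measurable_fun_pairP; split; apply: measurable_fun_rV => i;
  rewrite /comp /coor_rV /=; under eq_fun do rewrite mxE;
  exact: measurable_coor.
Qed.

HB.instance Definition _ n :=
  @isMeasurableFun.Build _ _ _ _ (@split_rV n) (@measurable_split_rV n).

Definition lebesgue_rV2 n : {measure set ('rV[R]_n * 'rV[R]_n) -> \bar R} :=
  image_measure (lebesgue_rV (n + n)) (@split_rV n).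

End lebesgue_rV.

Section ocd.
Context (R : realType) (n : nat).
Local Notation Rn := 'rV[R]_n.
Local Notation R2n := ('rV[R]_n * 'rV[R]_n)%type.

(* Euclidean norms; the library norms [`|x|] and [`|z|] are sup norms. *)
Definition enorm (x : Rn) : R := Num.sqrt (\sum_(i < n) x ord0 i ^+ 2).

Definition enorm2 (z : R2n) : R := Num.sqrt (enorm z.1 ^+ 2 + enorm z.2 ^+ 2).

Definition same_law d (T : measurableType d) (p q : set T -> \bar R) :=
  forall A, measurable A -> p A = q A.

Definition mixture (T : Type) (eps : R) (p q : set T -> \bar R) :
  set T -> \bar R := fun A => ((1 - eps)%:E * p A + eps%:E * q A)%E.

Definition finite_moment2 (mu : probability Rn R) : Prop :=
  (\int[mu]_x (enorm x ^+ 2)%:E < +oo)%E.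

Definition finite_moment2_pair (p : probability R2n R) : Prop :=
  (\int[p]_z (enorm2 z ^+ 2)%:E < +oo)%E.

Definition has_marginals d1 d2 (T1 : measurableType d1) (T2 : measurableType d2)
    (p : probability T1 R) (q : probability T2 R)
    (r : probability (T1 * T2)%type R) : Prop :=
  same_law (pushforward r fst) p /\ same_law (pushforward r snd) q.

Definition coupling (mu nu : probability Rn R) : set (probability R2n R) :=
  [set p | finite_moment2_pair p /\ has_marginals mu nu p].

Definition W2 (p q : probability R2n R) : \bar R :=
  (ereal_inf [set \int[r]_w (enorm2 (w.1 - w.2) ^+ 2)%:E
             | r in [set r | has_marginals p q r]] `^ (2^-1))%E.

Definition cost (c : R2n -> R) (p : probability R2n R) : \bar R :=
  (\int[p]_z (c z)%:E)%E.

Definition optimal_coupling (c : R2n -> R) (mu nu : probability Rn R)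
    (pi_opt : probability R2n R) : Prop :=
  coupling mu nu pi_opt /\
  forall p, coupling mu nu p -> (cost c pi_opt <= cost c p)%E.

Definition suboptimal_coupling (c : R2n -> R) (mu nu : probability Rn R)
    (pi_opt : probability R2n R) : set (probability R2n R) :=
  [set p | coupling mu nu p /\ (cost c pi_opt < cost c p)%E].

Fixpoint Ck (k : nat) (V : normedModType R) (f : V -> R) : Prop :=
  if k is j.+1 then
    (forall x, differentiable f x) /\ forall v, Ck j (fun x => 'D_v f x)
  else continuous f.

Definition smooth (V : normedModType R) (f : V -> R) : Prop :=
  forall k, Ck k f.

Definition grad_x (c : R2n -> R) (z : R2n) : Rn :=
  \row_(i < n) 'D_(delta_mx ord0 i, 0) c z.

Definition grad_y (c : R2n -> R) (z : R2n) : Rn :=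
  \row_(i < n) 'D_(0, delta_mx ord0 i) c z.

(* [L2norm m N f] is the L^2(m) norm of f when N is the Euclidean norm of the
   codomain of f. *)
Definition L2norm d (T : measurableType d) (m : {measure set T -> \bar R})
    (V : Type) (N : V -> R) (f : T -> V) : \bar R :=
  ('N[m]_2%:E[EFin \o (N \o f)])%E.

(* [cond_exp_given p k f g]: the Borel function g is a version of
   x |-> E_p[f(X,Y) | k(X,Y) = x], where (X,Y) ~ p; k is [fst] or [snd]. *)
Definition cond_exp_given (p : probability R2n R) (k : R2n -> Rn)
    (f : R2n -> Rn) (g : Rn -> Rn) : Prop :=
  measurable_fun [set: Rn] g /\
  forall i : 'I_n,
    [/\ p.-integrable setT (fun z => (f z ord0 i)%:E),
        p.-integrable setT (fun z => (g (k z) ord0 i)%:E) &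
        forall A : set Rn, measurable A ->
          (\int[p]_(z in k @^-1` A) (f z ord0 i)%:E =
           \int[p]_(z in k @^-1` A) (g (k z) ord0 i)%:E)%E].

Definition ocd_velocity (c : R2n -> R) (g h : R -> Rn -> Rn) (t : R) (z : R2n) :
  R2n := (- grad_x c z + g t z.1, - grad_y c z + h t z.2).

(* The state (X_t, Y_t) is the pair-valued random variable [Z t]. The right-hand
   side of the dynamics is defined only up to a null set at each time, as an
   element of L^2(Omega), so the time derivative is the mean-square one
   (one-sided at the endpoints of I). The Lipschitz clause of [regularity]
   makes the right-hand side continuous in L^2(Omega) along solutions. *)
Record ocd_solution d (Omega : measurableType d) (P : probability Omega R)
    (c : R2n -> R) (I : set R) (Z : R -> {RV P >-> R2n})
    (g h : R -> Rn -> Rn) : Prop := {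
  ocd_moment2 : forall t, I t -> (L2norm P enorm2 (Z t) < +oo)%E;
  ocd_condx : forall t, I t ->
    cond_exp_given (distribution P (Z t)) fst (grad_x c) (g t);
  ocd_condy : forall t, I t ->
    cond_exp_given (distribution P (Z t)) snd (grad_y c) (h t);
  ocd_derivative : forall t, I t ->
    L2norm P enorm2 (fun w => (u - t)^-1 *: (Z u w - Z t w)
                              - ocd_velocity c g h t (Z t w))
      @[u --> within I t^'] --> 0%E }.

(* Weak continuity in L^1 is tested against bounded measurable functions, which
   represent the dual of L^1. *)
Record regularity (mu nu : probability Rn R) (c : R2n -> R) (I : set R)
    (p : R -> probability R2n R) (g h : R -> Rn -> Rn) : Prop := {
  reg_density : exists rho : R -> R2n -> R,
    [/\ forall t, I t ->
          [/\ forall z, 0 <= rho t z,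
              (@lebesgue_rV2 R n).-integrable setT (fun z => (rho t z)%:E),
              forall A, measurable A ->
                (p t A = \int[@lebesgue_rV2 R n]_(z in A) (rho t z)%:E)%E &
              (\int[@lebesgue_rV2 R n]_z (enorm2 z ^+ 2 * rho t z)%:E
                 < +oo)%E],
        forall phi : R2n -> R, measurable_fun setT phi ->
          (exists M, forall z, `|phi z| <= M) ->
          {within I, continuous
             (fun t => \int[@lebesgue_rV2 R n]_z (phi z * rho t z))} &
        forall t, I t ->
          (\int[@lebesgue_rV2 R n]_z
             (enorm2 (ocd_velocity c g h t z) * rho t z)%:E < +oo)%E];
  reg_velocity : forall t, I t ->
    measurable_fun setT (ocd_velocity c g h t) /\
    (L2norm (p t) enorm2 (ocd_velocity c g h t) < +oo)%E;
  reg_cost : Ck 1 c /\ exists C : R, forall z,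
    enorm (grad_x c z) + enorm (grad_y c z) <= C * (1 + enorm z.1 + enorm z.2);
  reg_cond : forall t, I t ->
    [/\ cond_exp_given (p t) fst (grad_x c) (g t),
        (L2norm mu enorm (g t) < +oo)%E,
        cond_exp_given (p t) snd (grad_y c) (h t) &
        (L2norm nu enorm (h t) < +oo)%E];
  reg_lipschitz : exists2 L : R, 0 < L & forall q r : probability R2n R,
    coupling mu nu q -> coupling mu nu r ->
    (forall gq gr : Rn -> Rn,
       cond_exp_given q fst (grad_x c) gq ->
       cond_exp_given r fst (grad_x c) gr ->
       (L2norm mu enorm (fun x => gq x - gr x)%R <= L%:E * W2 q r)%E) /\
    (forall hq hr : Rn -> Rn,
       cond_exp_given q snd (grad_y c) hq ->
       cond_exp_given r snd (grad_y c) hr ->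
       (L2norm nu enorm (fun y => hq y - hr y)%R <= L%:E * W2 q r)%E) }.

End ocd.

(* Main.v *)
Require Import Defs.
From mathcomp Require Import all_boot all_order all_algebra.
From mathcomp Require Import all_classical all_reals all_analysis.
From mathcomp Require Import finmap measurable_realfun ring lra.

(** The expected cost [F t = E (c (X_t, Y_t))] never increases along a solution
of the dynamics, while mixing the sub-optimal law with the optimal one strictly
lowers the cost. The perturbed law therefore starts below the cost of the
sub-optimal law and can never come back to it.

Why [F] does not increase. Write [a_j] for the partial derivatives of [c] and
[b_j] for the version of the conditional expectation of [a_j] given the block,
[x] or [y], that contains coordinate [j]. The velocity is [v_j = b_j - a_j], and
formally [F' = E (\sum_j a_j v_j)]. Since [b_j] is a function of the block,
[v_j] is orthogonal to it in L^2 ([orthogonal_comp]), so that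
[F' = - E (\sum_j v_j ^ 2) <= 0] ([dissipation]).

Differentiation under the expectation is the delicate point, because the time
derivative exists only in mean square and the second derivatives of [c] need not
be bounded. Suppose that at some time [s] the slopes of [F] stay above some
[e > 0] along times tending to [s]. One can choose times [u_k] among these so
fast that the difference quotients [Q_k] of the state satisfy
[E |Q_k - v|^2 <= 2 ^ -(k + 1)]. Then [Phi = \sum_k |Q_k - v|^2] is integrable:
it dominates every [|Q_k - v|^2], and [Q_k] tends to [v] almost surely
([dominated_null_sequence]). As the gradient of [c] has linear growth, the
mean value theorem bounds the difference quotients of [c] by a multiple of
[1 + |z|^2 + |Q_k|^2] ([diff_quotient_bound]), and dominated convergence gives
the limit of the slopes of [F] ([diff_quotient_expectation_cvg]); it is at most
0, a contradiction. The pointwise estimate on slopes is globalized by a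
least-upper-bound argument, which spares a separate proof that [F] is continuous
at the endpoints ([le_of_slope_le0]). *)

Set Implicit Arguments.
Unset Strict Implicit.
Unset Printing Implicit Defensive.

Import Order.TTheory GRing.Theory Num.Theory.
Import numFieldNormedType.Exports.

Local Open Scope classical_set_scope.
Local Open Scope ring_scope.

(** * Coordinates and Euclidean norm on the product of two blocks *)

Section coordinates.
Context (R : realType) (n : nat).
Local Notation R2n := ('rV[R]_n * 'rV[R]_n)%type.
Local Notation idx := ('I_n + 'I_n)%type.

(** The sum type ['I_n + 'I_n] indexes the coordinates of both blocks at once, so
that the two blocks need not be treated separately. *)
Definition crd (j : idx) (z : R2n) : R :=
  match j with inl i => z.1 ord0 i | inr i => z.2 ord0 i end.

Definition basis_vec (j : idx) : R2n :=
  match j with inl i => (delta_mx ord0 i, 0) | inr i => (0, delta_mx ord0 i) end.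

(** The square of [enorm2], see [enorm2_sq]; squares are used throughout, as they
avoid Minkowski's inequality. *)
Definition sqn (z : R2n) : R := \sum_j crd j z ^+ 2.

Lemma crdD j z w : crd j (z + w) = crd j z + crd j w.
Proof. by case: j => i /=; rewrite mxE. Qed.

Lemma crdZ j a z : crd j (a *: z) = a * crd j z.
Proof. by case: j => i /=; rewrite mxE. Qed.

Lemma crdN j z : crd j (- z) = - crd j z.
Proof. by case: j => i /=; rewrite mxE. Qed.

Lemma crd0 j : crd j 0 = 0.
Proof. by case: j => i /=; rewrite mxE. Qed.

Lemma crd_basisE z : z = \sum_j crd j z *: basis_vec j.
Proof.
rewrite big_sumType /=; case: z => x y /=.
have sc (a : R) (u v : 'rV[R]_n) : a *: ((u, v) : R2n) = (a *: u, a *: v) by [].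
have pr1 (I : finType) (f : I -> R2n) : (\sum_i f i).1 = \sum_i (f i).1.
  by elim/big_rec2 : _ => // i ? ? _ <-.
have pr2 (I : finType) (f : I -> R2n) : (\sum_i f i).2 = \sum_i (f i).2.
  by elim/big_rec2 : _ => // i ? ? _ <-.
apply/pair_equal_spec; split.
  rewrite !pr1 /= [X in _ + X]big1 ?addr0.
    exact: row_sum_delta.
  by move=> i _; rewrite scaler0.
rewrite !pr2 /= [X in X + _]big1 ?add0r.
  exact: row_sum_delta.
by move=> i _; rewrite scaler0.
Qed.

Lemma sqn_ge0 z : 0 <= sqn z.
Proof. by apply: sumr_ge0 => j _; exact: sqr_ge0. Qed.

Lemma sqn0 : sqn 0 = 0.
Proof. by apply: big1 => j _; rewrite crd0 expr0n. Qed.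

Lemma enorm_sq (x : 'rV[R]_n) : enorm x ^+ 2 = \sum_i x ord0 i ^+ 2.
Proof. by rewrite sqr_sqrtr//; apply: sumr_ge0 => i _; exact: sqr_ge0. Qed.

Lemma enorm2_sq z : enorm2 z ^+ 2 = sqn z.
Proof.
rewrite sqr_sqrtr; last by rewrite addr_ge0 ?sqr_ge0.
by rewrite !enorm_sq /sqn big_sumType.
Qed.

Lemma sqnZ a z : sqn (a *: z) = a ^+ 2 * sqn z.
Proof. by rewrite /sqn mulr_sumr; apply: eq_bigr => j _; rewrite crdZ exprMn. Qed.

Lemma sqnN z : sqn (- z) = sqn z.
Proof. by apply: eq_bigr => j _; rewrite crdN sqrrN. Qed.

Lemma sqnD_le z w : sqn (z + w) <= 2 * sqn z + 2 * sqn w.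
Proof.
rewrite /sqn !mulr_sumr -big_split /=; apply: ler_sum => j _.
rewrite crdD; set a := crd j z; set b := crd j w.
have := sqr_ge0 (a - b); nra.
Qed.

Lemma crd_sq_le j z : crd j z ^+ 2 <= sqn z.
Proof.
rewrite /sqn (bigD1 j)//= lerDl; apply: sumr_ge0 => i _; exact: sqr_ge0.
Qed.

(** The topology of the product is given by sup norms; expanding on the basis
reduces convergence to that of finitely many real coefficients. *)
Lemma cvg_crd (I : Type) (F : set_system I) (FF : Filter F) (u : I -> R2n)
    (z : R2n) :
  (forall j, crd j (u i) @[i --> F] --> crd j z) -> u @ F --> z.
Proof.
move=> ucv; rewrite (crd_basisE z).
rewrite (_ : u = fun i => \sum_j crd j (u i) *: basis_vec j); last first.
  by apply/funext => i; exact: crd_basisE.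
apply: cvg_big => //; first exact: add_continuous.
by move=> j _; apply: cvgZr_tmp => //.
Qed.

Lemma measurable_crd j : measurable_fun [set: R2n] (crd j).
Proof.
case: j => i /=.
  exact: (measurableT_comp (@measurable_coor R n i) measurable_fst).
exact: (measurableT_comp (@measurable_coor R n i) measurable_snd).
Qed.

End coordinates.

(** * Difference quotients of a function with linearly growing gradient *)

Section calculus.
Context (R : realType) (n : nat).
Local Notation R2n := ('rV[R]_n * 'rV[R]_n)%type.
Local Notation idx := ('I_n + 'I_n)%type.
Variable c : R2n -> R.

Definition partial_deriv (j : idx) (z : R2n) : R := 'D_(basis_vec R j) c z.
Local Notation pd := partial_deriv.

Hypothesis c_diff : forall z, differentiable c z.
Hypothesis pd_cont : forall j, continuous (pd j).

Lemma deriveE_partial w z : 'D_w c z = \sum_j crd j w * pd j z.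
Proof.
rewrite deriveE// {1}(crd_basisE w) linear_sum /=.
by apply: eq_bigr => j _; rewrite linearZ /= /pd deriveE.
Qed.

Lemma MVT_line z w : exists2 s, 0 <= s <= 1 &
  c (z + w) - c z = \sum_j crd j w * pd j (z + s *: w).
Proof.
pose phi (s : R) := c (z + s *: w).
have dphi (s : R) : is_derive s 1 phi ('D_w c (z + s *: w)).
  have E : (fun h => h^-1 *: (phi (h *: 1 + s) - phi s)) =
           (fun h => h^-1 *: (c (h *: w + (z + s *: w)) - c (z + s *: w))).
    apply/funext => h; rewrite /phi; congr (_ *: (c _ - _)).
    by rewrite [h *: 1]mulr1 scalerDl addrCA.
  split; last by rewrite /derive E.
  rewrite /derivable E; exact/diff_derivable.
have cphi : {within `[0, 1], continuous phi}.
  apply: derivable_within_continuous => s _.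
  by have [] := dphi s.
have [s s01 E] := MVT ltr01 (fun s _ => dphi s) cphi.
exists s; first by move: s01; rewrite in_itv /= => /andP[/ltW -> /ltW ->].
move: E; rewrite /phi scale1r scale0r addr0 subr0 mulr1 => ->.
exact: deriveE_partial.
Qed.

Variables (K : R) (K_ge0 : 0 <= K).
Hypothesis pd_growth : forall z, \sum_j pd j z ^+ 2 <= K * (1 + sqn z).

(** Bounding each [a_j * q_j] by [a_j ^ 2 + q_j ^ 2] at the intermediate point
gives a bound that is quadratic in [z] and [q] and uniform in [r]; this is the
dominating function of the differentiation under the expectation. *)
Lemma diff_quotient_bound z q (r : R) : r != 0 -> `|r| <= 1 ->
  `|r^-1 * (c (z + r *: q) - c z)| <= (1 + 2 * K) * (1 + sqn z + sqn q).
Proof.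
move=> r0 r1; have [s /andP[s0 s1] ->] := MVT_line z (r *: q).
set z' := z + _.
have -> : r^-1 * (\sum_j crd j (r *: q) * pd j z') = \sum_j crd j q * pd j z'.
  rewrite mulr_sumr; apply: eq_bigr => j _.
  by rewrite crdZ -mulrA mulKf.
apply: (@le_trans _ _ (sqn q + \sum_j pd j z' ^+ 2)).
  apply: (le_trans (ler_norm_sum _ _ _)); rewrite /sqn -big_split /=.
  apply: ler_sum => j _; rewrite normrM.
  rewrite -(real_normK (num_real (crd j q))) -(real_normK (num_real (pd j z'))).
  set a := `|crd j q|; set b := `|pd j z'|.
  have := sqr_ge0 (a - b); have := normr_ge0 (crd j q).
  by rewrite -/a; have := normr_ge0 (pd j z'); rewrite -/b; nra.
have qz : sqn z' <= 2 * sqn z + 2 * sqn q.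
  apply: (le_trans (sqnD_le _ _)); rewrite lerD2l ler_pM2l// scalerA sqnZ.
  rewrite -[leRHS]mul1r ler_wpM2r ?sqn_ge0// -[X in X ^+ 2]/(s * r).
  rewrite -real_normK ?num_real// expr_le1// normrM mulr_ile1//.
  by rewrite ger0_norm.
have Kqz := ler_wpM2l K_ge0 qz.
have := pd_growth z'; have := sqn_ge0 z; have := sqn_ge0 q.
move: (sqn z') (sqn z) (sqn q) (\sum_j pd j z' ^+ 2) qz Kqz K_ge0 => a b d e; lra.
Qed.

(** The previous bound between the origin and [z], with [r = 1]. *)
Lemma cost_growth z : `|c z| <= `|c 0| + (1 + 2 * K) * (1 + sqn z).
Proof.
have := @diff_quotient_bound 0 z 1 (oner_neq0 _).
rewrite normr1 invr1 mul1r scale1r add0r sqn0 addr0 => /(_ (lexx _)) H.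
rewrite -[X in `|X|](subrK (c 0)) addrC; apply: (le_trans (ler_normD _ _)).
by rewrite lerD2l.
Qed.

(** Along moving directions the limit still exists, because the intermediate
points of the mean value theorem tend to [z], where the partial derivatives are
continuous. *)
Lemma diff_quotient_cvg z (q_ : nat -> R2n) (q : R2n) (r : nat -> R) :
  (forall k, r k != 0) -> r @ \oo --> 0 ->
  (forall j, crd j (q_ k) @[k --> \oo] --> crd j q) ->
  (r k)^-1 * (c (z + r k *: q_ k) - c z) @[k --> \oo]
    --> \sum_j crd j q * pd j z.
Proof.
move=> r0 rcv qcv.
have /choice[s sP] : forall k, exists s, 0 <= s <= 1 /\
    c (z + r k *: q_ k) - c z =
    \sum_j crd j (r k *: q_ k) * pd j (z + s *: (r k *: q_ k)).
  by move=> k; have [s] := MVT_line z (r k *: q_ k); exists s.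
rewrite (_ : (fun k => _) = fun k =>
    \sum_j crd j (q_ k) * pd j (z + s k *: (r k *: q_ k))); last first.
  apply/funext => k; have [_ ->] := sP k; rewrite mulr_sumr; apply: eq_bigr => j _.
  by rewrite crdZ -mulrA mulKf.
have zcv : z + s k *: (r k *: q_ k) @[k --> \oo] --> z.
  apply: cvg_crd => j; under eq_fun do rewrite crdD crdZ crdZ.
  suff : crd j z + s k * (r k * crd j (q_ k)) @[k --> \oo] --> crd j z + 0.
    by rewrite addr0.
  apply: cvgD; first exact: cvg_cst.
  have rq : r k * crd j (q_ k) @[k --> \oo] --> 0.
    by rewrite -(mul0r (crd j q)); apply: cvgM => //; exact: qcv.
  apply/norm_cvg0P.
  apply: (@squeeze_cvgr _ _ _ _ (fun=> 0) (fun k => `|r k * crd j (q_ k)|)).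
  - apply: nearW => k; rewrite normr_ge0 normrM ler_piMl//.
    by have [/andP[s0 s1] _] := sP k; rewrite ger0_norm.
  - exact: cvg_cst.
  - exact/norm_cvg0P.
apply: cvg_big => [|j _]; first exact: add_continuous.
apply: cvgM; first exact: qcv.
exact: (continuous_cvg _ (@pd_cont j z) zcv).
Qed.

End calculus.

(** * Borel measurability and orthogonality to functions of a block *)

Section borel.
Context (R : realType) (n : nat).
Local Notation R2n := ('rV[R]_n * 'rV[R]_n)%type.
Local Notation idx := ('I_n + 'I_n)%type.

Let cube (qk : {ffun idx -> rat} * nat) : set R2n :=
  [set z | forall j, crd j z \in `](ratr (qk.1 j) - qk.2.+1%:R^-1 : R),
                                   (ratr (qk.1 j) + qk.2.+1%:R^-1)[].

Let measurable_cube qk : measurable (cube qk).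
Proof.
rewrite (_ : cube qk = \bigcap_(j in [set: idx])
    (crd j @^-1` [set` `](ratr (qk.1 j) - qk.2.+1%:R^-1 : R),
                          (ratr (qk.1 j) + qk.2.+1%:R^-1)[])); last first.
  by apply/seteqP; split => z /= H j; [move=> _; exact: H|exact: (H j Logic.I)].
apply: fin_bigcap_measurable => // j _.
by rewrite -[X in measurable X]setTI; exact: measurable_crd.
Qed.

(** The sigma-algebra is generated by coordinates, the topology by sup norms: an
open set is the union of the rational cubes that it contains, of which there are
countably many. *)
Lemma open_measurable_rV2 (U : set R2n) : open U -> measurable U.
Proof.
move=> oU.
rewrite (_ : U = \bigcup_qk (if `[< cube qk `<=` U >] then cube qk else set0)).
  apply: countable_bigcupT_measurable => [|qk]; first exact: countableP.
  by case: ifP.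
apply/seteqP; split => [z Uz|z [qk _]]; last first.
  by case: ifPn => // /asboolP; exact.
have /nbhs_ballP[e /= e0 eU] := oU z Uz.
have [k ke] : exists k : nat, 2 * k.+1%:R^-1 < e.
  have [k] := near_infty_natSinv_lt (PosNum (divr_gt0 e0 (ltr0n R 2))).
  move=> _ /(_ k (leqnn k)) /=; exists k.
  by rewrite mulrC -ltr_pdivlMr.
have /choice[q qP] : forall j : idx, exists r : rat,
    ratr r \in `](crd j z - k.+1%:R^-1), (crd j z + k.+1%:R^-1)[.
  move=> j; apply: rat_in_itvoo.
  rewrite ltrBlDr -addrA ltrDl -mulr2n pmulrn_lgt0//.
pose qk := ([ffun j => q j], k).
exists qk => //; rewrite ifT.
  move=> j; rewrite /= ffunE; move: (qP j); rewrite !in_itv /=.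
  move: (k.+1%:R^-1) => ek; lra.
apply/asboolP => y Hy; apply: eU.
have H j : `|crd j z - crd j y| < e.
  move: (Hy j) (qP j); rewrite /= ffunE !in_itv /=; move: ke.
  rewrite ltr_norml; move: (k.+1%:R^-1) => ek; lra.
split; split=> // i j; rewrite ord1.
  exact: (H (inl j)).
exact: (H (inr j)).
Qed.

Lemma continuous_measurable_rV2 (f : R2n -> R) :
  continuous f -> measurable_fun setT f.
Proof.
move=> /continuousP cf; apply: (measurability _ (RGenOpens.measurableE R)).
move=> _ [_ [a [b ->] <-]]; rewrite setTI; apply: open_measurable_rV2.
exact/cf/interval_open.
Qed.

End borel.

Section orthogonality.
Import HBNNSimple.
Context d d' (T : measurableType d) (T' : measurableType d') (R : realType).
Variables (m : {measure set T -> \bar R}) (k : T -> T') (u : T -> R).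
Hypothesis mk : measurable_fun setT k.
Hypothesis iu : m.-integrable setT (EFin \o u).
Hypothesis u0 : forall A, measurable A -> (\int[m]_(x in k @^-1` A) (u x)%:E = 0)%E.

Let meas_u : measurable_fun setT u.
Proof. by apply/measurable_EFinP; exact: measurable_int iu. Qed.

(* A simple function of [k] is a finite combination of indicators of sets
   [k @^-1` A], on each of which the integral of [u] vanishes. *)
Let orthogonal_nnsfun (f : {nnsfun T' >-> R}) :
  (\int[m]_x (u x * f (k x))%:E = 0)%E.
Proof.
set s := fset_set (f @` setT).
have mE (i : 'I_#|`s|) : measurable (k @^-1` (f @^-1` [set s`_i])).
  rewrite -[X in measurable X]setTI; exact: mk.
have iE (i : 'I_#|`s|) : m.-integrable setT
    (fun x => (s`_i * (u x * \1_(f @^-1` [set s`_i]) (k x)))%:E).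
  apply: (@integrableZl _ _ _ _ _ measurableT s`_i
    (fun x => (u x * \1_(f @^-1` [set s`_i]) (k x))%:E)).
  have := iu; move/(integrableS measurableT (mE i) (@subsetT _ _)).
  move/(integrable_mkcond _ (mE i)).1; apply: eq_integrable => // x _ /=.
  rewrite restrict_EFin /= patchE /= indicE /=.
  have -> : (x \in k @^-1` (f @^-1` [set s`_i])) = (k x \in f @^-1` [set s`_i]).
    by [].
  by case: ifPn; rewrite ?mulr1 ?mulr0.

transitivity (\int[m]_x (\sum_(i < #|`s|)
    (s`_i * (u x * \1_(f @^-1` [set s`_i]) (k x)))%:E))%E.
  apply: eq_integral => x _; rewrite (fimfunEord f) -/s mulr_sumr sumEFin.
  by congr EFin; apply: eq_bigr => i _; rewrite mulrCA.
rewrite integral_sum// big1// => i _.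
transitivity (\int[m]_(x in k @^-1` (f @^-1` [set s`_i])) ((s`_i)%:E * (u x)%:E))%E.
  rewrite [RHS]integral_mkcond; apply: eq_integral => x _.
  rewrite patchE -EFinM indicE.
  have -> : (x \in k @^-1` (f @^-1` [set s`_i])) = (k x \in f @^-1` [set s`_i]).
    by [].
  by case: ifPn; rewrite ?mulr1 ?mulr0.
rewrite integralZl//; last exact: integrableS iu.
by rewrite u0 ?mule0.
Qed.

(* The simple approximations of [f] stay below [f], so that the absolute value
   of [u * (f \o k)] dominates the products. *)
Let orthogonal_ge0 (f : T' -> R) : measurable_fun setT f ->
    (forall y, 0 <= f y) ->
    m.-integrable setT (fun x => (u x * f (k x))%:E) ->
  (\int[m]_x (u x * f (k x))%:E = 0)%E.
Proof.
move=> mf f0 iuf.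
have mef : measurable_fun setT (EFin \o f) by exact/measurable_EFinP.
pose f_ := nnsfun_approx measurableT mef.
have fcv y : EFin (f_ ^~ y i) @[i --> \oo] --> (f y)%:E.
  by apply: (@cvg_nnsfun_approx _ _ _ setT measurableT _ mef) => //= x _; rewrite lee_fin.
have fle i y : f_ i y <= f y.
  rewrite -lee_fin /f_ nnsfun_approxE.
  by apply: (@le_approx _ _ _ setT) => //= x _; rewrite lee_fin.
have [] := @dominated_convergence _ _ _ m setT measurableT
  (fun i x => (u x * f_ i (k x))%:E) (fun x => (u x * f (k x))%:E)
  (fun x => `|(u x * f (k x))%:E|%E).
- move=> i; apply/measurable_EFinP; apply: measurable_funM => //.
  by apply: measurableT_comp => //; exact: mk.
- exact: measurable_int iuf.
- apply: aeW => x _ /=; under eq_fun do rewrite EFinM.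
  rewrite EFinM; apply: cvgeZl => //; exact: fcv.
- exact: integrable_abse.
- apply: aeW => x i _ /=; rewrite lee_fin !normrM ler_wpM2l// !ger0_norm//.
move=> _ _ H; apply/esym; apply: cvg_unique H => //.
rewrite (_ : [sequence _]_n = fun=> 0%E); first exact: cvg_cst.
by apply/funext => i; exact: orthogonal_nnsfun.
Qed.

(** This is the defining property of conditional expectations (with [u] the
difference between a function and its conditional expectation), extended from
indicators of sets in the sigma-algebra of [k] to all functions of [k] for which
the product is integrable. *)
Lemma orthogonal_comp (f : T' -> R) : measurable_fun setT f ->
    m.-integrable setT (fun x => (u x * f (k x))%:E) ->
  (\int[m]_x (u x * f (k x))%:E = 0)%E.
Proof.
move=> mf iuf.
pose p y := Num.max (f y) 0; pose q y := Num.max (- f y) 0.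
have mp : measurable_fun setT p by exact: measurable_funrpos.
have mq : measurable_fun setT q by exact: measurable_funrneg.
have fE y : f y = p y - q y by rewrite /p /q !maxEle; do 2 case: leP => ?; lra.
have p0 y : 0 <= p y by rewrite le_max lexx orbT.
have q0 y : 0 <= q y by rewrite le_max lexx orbT.
have ip : m.-integrable setT (fun x => (u x * p (k x))%:E).
  apply: le_integrable iuf => //.
    apply/measurable_EFinP; apply: measurable_funM => //.
    by apply: measurableT_comp => //; exact: mk.
  move=> x _ /=; rewrite lee_fin !normrM ler_wpM2l// ger0_norm//.
  by rewrite /p ge_max normr_ge0 ler_norm.
have iq : m.-integrable setT (fun x => (u x * q (k x))%:E).
  apply: le_integrable iuf => //.
    apply/measurable_EFinP; apply: measurable_funM => //.
    by apply: measurableT_comp => //; exact: mk.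
  move=> x _ /=; rewrite lee_fin !normrM ler_wpM2l// ger0_norm//.
  by rewrite /q ge_max normr_ge0 -normrN ler_norm.
under eq_integral do rewrite fE mulrBr EFinB.
by rewrite integralB// !orthogonal_ge0// sube0.
Qed.

End orthogonality.

(** * Differentiation under the expectation *)

Section measurability.
Context (R : realType) (n : nat) d (T : measurableType d).
Local Notation R2n := ('rV[R]_n * 'rV[R]_n)%type.
Local Notation idx := ('I_n + 'I_n)%type.

Lemma measurable_crd_comp (f : T -> R2n) j :
  measurable_fun setT f -> measurable_fun setT (fun x => crd j (f x)).
Proof. by move=> mf; apply: measurableT_comp => //; exact: measurable_crd. Qed.

Lemma measurable_sqn (f : T -> R2n) :
  (forall j, measurable_fun setT (fun x => crd j (f x))) ->
  measurable_fun setT (fun x => sqn (f x)).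
Proof.
move=> mf; apply: measurable_sum => j.
exact: measurable_funX.
Qed.

End measurability.

(** A sequence whose integrals are summable tends to 0 almost everywhere and is
dominated by its sum, which is integrable by monotone convergence. *)
Section square_summable.
Context d (T : measurableType d) (R : realType) (P : {measure set T -> \bar R}).
Variable u_ : nat -> T -> R.
Hypothesis mu_ : forall k, measurable_fun setT (u_ k).
Hypothesis u_ge0 : forall k x, 0 <= u_ k x.
Hypothesis u_small : forall k,
  (\int[P]_x (u_ k x)%:E <= (1 / (2 ^ k.+1)%:R)%:E)%E.

Let Phi x : \bar R := (\sum_(k <oo) (u_ k x)%:E)%E.

Let iPhi : P.-integrable setT Phi.
Proof.
have Phi0 x : (0 <= Phi x)%E by apply: nneseries_ge0 => k _ _; rewrite lee_fin.
apply/integrableP; split.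
  by apply: ge0_emeasurable_sum => [k x _ _|k _];
    [rewrite lee_fin|exact/measurable_EFinP].
under eq_integral do rewrite gee0_abs//.
rewrite integral_nneseries//; last 2 first.
- by move=> k; exact/measurable_EFinP.
- by move=> k x _; rewrite lee_fin.
apply: (@le_lt_trans _ _ 1%:E); last exact: ltry.
apply: le_trans (@epsilon_trick0 R 1 xpredT ler01).
apply: lee_nneseries => k _; last exact: u_small.
by move=> _; apply: integral_ge0 => x _; rewrite lee_fin.
Qed.

Lemma dominated_null_sequence : exists Phi : T -> \bar R,
  [/\ P.-integrable setT Phi,
      forall k x, ((u_ k x)%:E <= Phi x)%E &
      {ae P, forall x, u_ ^~ x @ \oo --> 0}].
Proof.
exists Phi; split => //.
- move=> k x; rewrite /Phi.
  apply: le_trans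
    (@nneseries_lim_ge _ (fun k => (u_ k x)%:E) xpredT 0 k.+1 _); last first.
    by move=> i _ _; rewrite lee_fin.
  rewrite big_nat_recr//= leeDr//.
  by apply: sume_ge0 => i _; rewrite lee_fin.
have := integrable_ae measurableT iPhi; apply: filterS => x /(_ Logic.I) fx.
apply: cvg_series_cvg_0; apply: nnseries_is_cvg => [k|]; first exact: u_ge0.
by move: fx; rewrite ge0_fin_numE//; apply: nneseries_ge0 => k _ _; rewrite lee_fin.
Qed.

End square_summable.

Section differentiation_under_expectation.
Context (R : realType) (n : nat) d (T : measurableType d)
  (P : probability T R).
Local Notation R2n := ('rV[R]_n * 'rV[R]_n)%type.
Local Notation idx := ('I_n + 'I_n)%type.
Variables (c : R2n -> R) (K : R).
Local Notation pd := (partial_deriv c).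
Hypothesis c_diff : forall z, differentiable c z.
Hypothesis pd_cont : forall j, continuous (pd j).
Hypothesis K_ge0 : 0 <= K.
Hypothesis pd_growth : forall z, \sum_j pd j z ^+ 2 <= K * (1 + sqn z).

Lemma measurable_cost_comp (f : T -> R2n) : measurable_fun setT f ->
  measurable_fun setT (fun x => c (f x)).
Proof.
move=> mf; apply: measurableT_comp => //; apply: continuous_measurable_rV2.
by move=> z; exact: differentiable_continuous.
Qed.

Lemma measurable_pd_comp (f : T -> R2n) j : measurable_fun setT f ->
  measurable_fun setT (fun x => pd j (f x)).
Proof.
by move=> mf; apply: measurableT_comp => //; exact: continuous_measurable_rV2.
Qed.

Lemma integrable_cost (f : T -> R2n) : measurable_fun setT f ->
  P.-integrable setT (fun x => (sqn (f x))%:E) ->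
  P.-integrable setT (fun x => (c (f x))%:E).
Proof.
move=> mf if2.
have H : P.-integrable setT
    (fun x => ((`|c 0| + (1 + 2 * K)) + (1 + 2 * K) * sqn (f x))%:E).
  under eq_fun do rewrite EFinD EFinM.
  apply: integrableD => //; last exact: integrableZl.
  exact: finite_measure_integrable_cst.
apply: le_integrable H => //.
  by apply/measurable_EFinP; exact: measurable_cost_comp.
move=> x _; rewrite /= lee_fin (le_trans (cost_growth c_diff K_ge0 pd_growth _))//.
by rewrite (le_trans _ (ler_norm _))// mulrDr mulr1 addrA.
Qed.

Variables (W V : T -> R2n) (W_ : nat -> T -> R2n) (r : nat -> R).
Hypothesis mW : measurable_fun setT W.
Hypothesis mV : forall j, measurable_fun setT (fun x => crd j (V x)).
Hypothesis mW_ : forall k, measurable_fun setT (W_ k).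
Hypothesis iW : P.-integrable setT (fun x => (sqn (W x))%:E).
Hypothesis iV : P.-integrable setT (fun x => (sqn (V x))%:E).
Hypothesis r_neq0 : forall k, r k != 0.
Hypothesis r_le1 : forall k, `|r k| <= 1.
Hypothesis r_cvg0 : r @ \oo --> 0.
Local Notation Q k x := ((r k)^-1 *: (W_ k x - W x)).
Hypothesis Q_small : forall k,
  (\int[P]_x (sqn (Q k x - V x))%:E <= (1 / (2 ^ k.+1)%:R)%:E)%E.

(** The state [W] moves by [W_ k - W = r k *: Q k], where [Q k] tends to [V] fast
in mean square. Since [sqn (Q k)] is at most [2 * sqn (Q k - V) + 2 * sqn V],
the sum [Phi] of all [sqn (Q k - V)] makes the bound of [diff_quotient_bound]
uniform in [k] and integrable. *)
Lemma diff_quotient_expectation_cvg :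
  P.-integrable setT (fun x => (\sum_j crd j (V x) * pd j (W x))%:E) /\
  (\int[P]_x ((r k)^-1 * (c (W_ k x) - c (W x)))%:E @[k --> \oo] -->
   \int[P]_x (\sum_j crd j (V x) * pd j (W x))%:E)%E.
Proof.
have mu_ k : measurable_fun setT (fun x => sqn (Q k x - V x)).
  apply: measurable_sqn => j; under eq_fun do rewrite crdD crdN crdZ crdD crdN.
  apply: measurable_funB => //; apply: measurable_funM => //.
  by apply: measurable_funB => //; exact: measurable_crd_comp.
have [Phi [iPhi uPhi u0]] := dominated_null_sequence mu_
  (fun k x => sqn_ge0 _) Q_small.
have WE k x : W_ k x = W x + r k *: Q k x.
  by rewrite scalerA divff// scale1r addrC subrK.
pose M := 1 + 2 * K.
have M0 : 0 <= M by rewrite addr_ge0// mulr_ge0.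
have [] := @dominated_convergence _ _ _ P setT measurableT
  (fun k x => ((r k)^-1 * (c (W_ k x) - c (W x)))%:E)
  (fun x => (\sum_j crd j (V x) * pd j (W x))%:E)
  (fun x => (M * (1 + sqn (W x) + 2 * sqn (V x)))%:E + (M * 2)%:E * Phi x)%E.
- move=> k; apply/measurable_EFinP; apply: measurable_funM => //.
  by apply: measurable_funB; exact: measurable_cost_comp.
- apply/measurable_EFinP; apply: measurable_sum => j; apply: measurable_funM => //.
  exact: measurable_pd_comp.
- move: u0; apply: filterS => x u0 _.
  have Qcv j : crd j (Q k x) @[k --> \oo] --> crd j (V x).
    apply/subr_cvg0; apply/norm_cvg0P.
    apply: (@squeeze_cvgr _ _ _ _ (fun=> 0)
      (fun k => Num.sqrt (sqn (Q k x - V x)))).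
    - apply: nearW => k; rewrite normr_ge0/= -sqrtr_sqr ler_wsqrtr//.
      by rewrite -crdN -crdD crd_sq_le.
    - exact: cvg_cst.
    - suff : Num.sqrt (sqn (Q k x - V x)) @[k --> \oo] --> Num.sqrt 0.
        by rewrite sqrtr0.
      apply: continuous_cvg u0.
      exact: sqrt_continuous.
  have := diff_quotient_cvg c_diff pd_cont (z := W x) r_neq0 r_cvg0 Qcv.
  under eq_fun do rewrite -WE.
  by move=> H; apply: cvg_EFin => //; exact: nearW.
- apply: integrableD => //; last exact: integrableZl.
  under eq_fun do rewrite EFinM.
  apply: integrableZl => //.
  under eq_fun do rewrite EFinD EFinM EFinD.
  apply: integrableD => //; last exact: integrableZl.
  by apply: integrableD => //; exact: finite_measure_integrable_cst.
- apply: aeW => x k _ /=; rewrite {1}WE.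
  have QV : sqn (Q k x) <= 2 * sqn (Q k x - V x) + 2 * sqn (V x).
    by rewrite -{1}(subrK (V x) (Q k x)) sqnD_le.
  rewrite (@le_trans _ _ (M * (1 + sqn (W x) + 2 * sqn (V x)) +
    (M * 2) * sqn (Q k x - V x))%:E)//; last first.
    by rewrite EFinD leeD2l// EFinM lee_wpmul2l// lee_fin mulr_ge0.
  rewrite lee_fin.
  apply: le_trans (diff_quotient_bound c_diff K_ge0 pd_growth _ _ _ _) _ => //.
  by rewrite -/M -mulrA -mulrDr ler_wpM2l//; lra.
by move=> iVW _ cvVW; split.
Qed.

End differentiation_under_expectation.

(** * Dissipation of the cost *)

Section L2.
Context (R : realType) (n : nat) d (T : measurableType d)
  (m : {measure set T -> \bar R}).
Local Notation R2n := ('rV[R]_n * 'rV[R]_n)%type.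
Implicit Type f : T -> R2n.

Lemma L2norm_sqr f : ((L2norm m (@enorm2 R n) f) `^ 2 = \int[m]_x (sqn (f x))%:E)%E.
Proof.
rewrite /L2norm poweR_Lnorm//; apply: eq_integral => x _ /=.
by rewrite powR_mulrn// real_normK ?num_real// enorm2_sq.
Qed.

Lemma L2norm_lt f (e : R) : (L2norm m (@enorm2 R n) f < e%:E)%E ->
  (\int[m]_x (sqn (f x))%:E <= (e ^+ 2)%:E)%E.
Proof.
rewrite -L2norm_sqr; have : (0 <= L2norm m (@enorm2 R n) f)%E by exact: Lnorm_ge0.
case: (L2norm _ _ _) => [r| |]//=; rewrite !lee_fin lte_fin => r0 re.
by rewrite powR_mulrn// lerXn2r// ?nnegrE ?(ltW (le_lt_trans r0 re))// ltW.
Qed.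

Lemma L2norm_integrable f :
  (forall j, measurable_fun setT (fun x => crd j (f x))) ->
  (L2norm m (@enorm2 R n) f < +oo)%E ->
  m.-integrable setT (fun x => (sqn (f x))%:E).
Proof.
move=> mf; have : (0 <= L2norm m (@enorm2 R n) f)%E by exact: Lnorm_ge0.
move=> f0 foo; apply/integrableP; split.
  exact/measurable_EFinP/measurable_sqn.
under eq_integral do rewrite gee0_abs ?lee_fin ?sqn_ge0//.
rewrite -L2norm_sqr; move: f0 foo; case: (L2norm _ _ _) => [r| |]//=.
by move=> _ _; rewrite ltry.
Qed.

End L2.

Section dissipation.
Context (R : realType) (n : nat).
Local Notation R2n := ('rV[R]_n * 'rV[R]_n)%type.
Local Notation Rn := ('rV[R]_n).
Local Notation idx := ('I_n + 'I_n)%type.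
Variables (c : R2n -> R) (p : probability R2n R) (g h : Rn -> Rn) (K : R).
Local Notation pd := (partial_deriv c).
Hypothesis gP : cond_exp_given p fst (grad_x c) g.
Hypothesis hP : cond_exp_given p snd (grad_y c) h.
Hypothesis pd_growth : forall z, \sum_j pd j z ^+ 2 <= K * (1 + sqn z).

Let V (z : R2n) : R2n := (- grad_x c z + g z.1, - grad_y c z + h z.2).
Hypothesis p2 : p.-integrable setT (fun z => (sqn z)%:E).
Hypothesis V2 : p.-integrable setT (fun z => (sqn (V z))%:E).

Let block (j : idx) : R2n -> Rn := if j is inl _ then fst else snd.
Let ce (j : idx) : Rn -> R :=
  match j with inl i => fun x => g x ord0 i | inr i => fun y => h y ord0 i end.

Let mblock j : measurable_fun setT (block j).
Proof. by case: j => i; [exact: measurable_fst|exact: measurable_snd]. Qed.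

Let mce j : measurable_fun setT (ce j).
Proof.
case: j => i /=.
  exact: measurableT_comp (@measurable_coor R n i) gP.1.
exact: measurableT_comp (@measurable_coor R n i) hP.1.
Qed.

Let ceP j : [/\ p.-integrable setT (fun z => (pd j z)%:E),
  p.-integrable setT (fun z => (ce j (block j z))%:E) &
  forall A : set Rn, measurable A ->
     (\int[p]_(z in block j @^-1` A) (pd j z)%:E =
      \int[p]_(z in block j @^-1` A) (ce j (block j z))%:E)%E].
Proof.
have gE i : (fun z => (grad_x c z ord0 i)%:E) = (fun z => (pd (inl i) z)%:E).
  by apply/funext => z; rewrite mxE.
have hE i : (fun z => (grad_y c z ord0 i)%:E) = (fun z => (pd (inr i) z)%:E).
  by apply/funext => z; rewrite mxE.
by case: j => i; [have := gP.2 i; rewrite gE|have := hP.2 i; rewrite hE].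
Qed.

Let crdV j z : crd j (V z) = - pd j z + ce j (block j z).
Proof. by case: j => i; rewrite /V /= !mxE. Qed.

Let mpd j : measurable_fun setT (pd j).
Proof. by have [/measurable_int/measurable_EFinP] := ceP j. Qed.

Let mceb j : measurable_fun setT (fun z => ce j (block j z)).
Proof. exact: measurableT_comp. Qed.

(** Measurability of the partial derivatives is part of the integrability
contained in [cond_exp_given]. *)
Lemma measurable_velocity j : measurable_fun setT (fun z => crd j (V z)).
Proof.
under eq_fun do rewrite crdV.
by apply: measurable_funD => //; exact: measurable_funN.
Qed.

Let pd2 j : p.-integrable setT (fun z => (pd j z ^+ 2)%:E).
Proof.
have : p.-integrable setT (fun z => (K + K * sqn z)%:E).
  under eq_fun do rewrite EFinD EFinM.
  apply: integrableD => //; last exact: integrableZl.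
  exact: finite_measure_integrable_cst.
apply: le_integrable => //.
  by apply/measurable_EFinP; exact: measurable_funX.
move=> z _ /=; rewrite lee_fin ger0_norm ?sqr_ge0//.
apply: le_trans (ler_norm _); rewrite -{1}(mulr1 K) -mulrDr.
apply: le_trans (pd_growth z); rewrite (bigD1 j)//= lerDl.
by apply: sumr_ge0 => i _; exact: sqr_ge0.
Qed.

Let Vj2 j : p.-integrable setT (fun z => (crd j (V z) ^+ 2)%:E).
Proof.
move: V2; apply: le_integrable => //.
  by apply/measurable_EFinP; apply: measurable_funX; exact: measurable_velocity.
move=> z _ /=; rewrite lee_fin ger0_norm ?sqr_ge0//.
by apply: le_trans (ler_norm _); exact: crd_sq_le.
Qed.

(* The conditional expectation [ce] is [V + pd], a sum of two square-integrable
   functions: its square-integrability comes from that of the velocity. *)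
Let Vce j : p.-integrable setT (fun z => (crd j (V z) * ce j (block j z))%:E).
Proof.
have : p.-integrable setT (fun z => (2 * crd j (V z) ^+ 2 + pd j z ^+ 2)%:E).
  under eq_fun do rewrite EFinD EFinM.
  by apply: integrableD => //; exact: integrableZl.
apply: le_integrable => //.
  by apply/measurable_EFinP; apply: measurable_funM => //; exact: measurable_velocity.
move=> z _ /=; rewrite lee_fin; apply: le_trans (ler_norm _).
rewrite (_ : ce j _ = crd j (V z) + pd j z); last by rewrite crdV; ring.
move: (crd j (V z)) (pd j z) => v a.
have := sqr_ge0 (v + a); have := sqr_ge0 (v - a).
by rewrite ler_norml; nra.
Qed.

Let orth j : (\int[p]_z (crd j (V z) * ce j (block j z))%:E = 0)%E.
Proof.
have [i1 i2 ij] := ceP j.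
apply: (@orthogonal_comp _ _ _ _ _ p (block j) (fun z => crd j (V z))) => //.
  rewrite /comp; under eq_fun do rewrite crdV EFinD EFinN.
  by apply: integrableD => //; exact: integrableN.
move=> A mA.
have mbA : measurable (block j @^-1` A).
  by rewrite -[X in measurable X]setTI; exact: mblock.
have i1A := integrableS measurableT mbA (@subsetT _ _) i1.
have i2A := integrableS measurableT mbA (@subsetT _ _) i2.
under eq_integral do rewrite crdV addrC EFinB.
by rewrite integralB// ij// subee// integrable_fin_num.
Qed.

(** The velocity [V = ce - pd] is orthogonal to [ce], hence
[V * pd = V * ce - V ^ 2] integrates to minus the integral of [V ^ 2]. *)
Lemma dissipation : (\int[p]_z (\sum_j crd j (V z) * pd j z)%:E <= 0)%E.
Proof.
under eq_integral do rewrite -sumEFin.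
have E j z : (crd j (V z) * pd j z)%:E =
    ((crd j (V z) * ce j (block j z))%:E - (crd j (V z) ^+ 2)%:E)%E.
  by rewrite -EFinB crdV; congr EFin; ring.
have iE j : p.-integrable setT (fun z => (crd j (V z) * pd j z)%:E).
  by under eq_fun do rewrite E; exact: integrableB.
rewrite integral_sum//; apply: sume_le0 => j _.
under eq_integral do rewrite E.
rewrite integralB// orth sub0e oppe_le0.
by apply: integral_ge0 => z _; rewrite lee_fin sqr_ge0.
Qed.

End dissipation.

(** * Monotonicity of the cost along a solution *)

(** The hypothesis says that the upper derivatives of [F], relative to the
interval, are at most 0. For a slope [e > 0], let [s] be the supremum of the
times at which [F] lies below the line of slope [e] through [(a, F a)]: slopes to
the left of [s] show that [s] is such a time, slopes to its right that
[s = b]. *)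
Lemma le_of_slope_le0 (R : realType) (F : R -> R) (a b : R) : a <= b ->
  (forall s e, a <= s <= b -> 0 < e -> exists2 dl, 0 < dl &
     forall u, a <= u <= b -> u != s -> `|u - s| < dl ->
       (u - s)^-1 * (F u - F s) <= e) ->
  F b <= F a.
Proof.
move=> ab Fle.
suff H e : 0 < e -> F b <= F a + e * (b - a).
  apply/ler_addgt0Pr => e e0.
  have ba : 0 < b - a + 1 by lra.
  apply: (le_trans (H (e / (b - a + 1)) (divr_gt0 e0 ba))).
  rewrite lerD2l -mulrA ler_piMr ?(ltW e0)// ler_pdivrMl//; lra.
move=> e0.
pose A := [set s | a <= s <= b /\ F s <= F a + e * (s - a)].
have Aa : A a by split; [rewrite lexx|rewrite subrr mulr0 addr0].
have ubA : ubound A b by move=> s [/andP[]].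
have hA : has_sup A by split; [exists a|exists b].
set s := sup A.
have as_ : a <= s by apply: ub_le_sup => //; exists b.
have sb : s <= b by apply: ge_sup => //; exists a.
have s_in : a <= s <= b by rewrite as_.
have [dl dl0 sl] := Fle s e s_in e0.
have As : A s.
  have [t At st] := sup_adherent dl0 hA.
  have ts : t <= s by apply: ub_le_sup => //; exists b.
  have [->//|nts] := eqVneq s t.
  have [tab Ft] := At.
  have := sl t tab; rewrite eq_sym nts => /(_ isT).
  rewrite -/s in st.
  have {}ts : t < s by rewrite lt_neqAle eq_sym nts.
  rewrite ltr0_norm; last by lra.
  have sst : - (t - s) < dl by lra.
  move=> /(_ sst); rewrite ler_ndivrMl; last by lra.
  move=> H; split => //; lra.
have [bs|sb'] := leP b s.
  have bsE : b = s by apply/le_anti; rewrite bs sb.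
  by have [_] := As; rewrite -bsE.
pose u := Num.min b (s + dl / 2).
have su : s < u by rewrite lt_min sb' ltrDl divr_gt0.
have ub : u <= b by rewrite ge_min lexx.
have us : u <= s + dl / 2 by rewrite ge_min lexx orbT.
have uab : a <= u <= b by rewrite ub andbT; lra.
have := sl u uab; rewrite gt_eqF// => /(_ isT).
rewrite gtr0_norm; last by lra.
have usd : u - s < dl by lra.
move=> /(_ usd); rewrite ler_pdivrMl; last by lra.
move=> H.
suff Au : A u by have := ub_le_sup (ex_intro _ b ubA) Au; rewrite -/s leNgt su.
by split => //; have [_ As2] := As; lra.
Qed.

Section energy.
Context (R : realType) (n : nat) d (Omega : measurableType d)
  (P : probability Omega R).
Local Notation R2n := ('rV[R]_n * 'rV[R]_n)%type.
Local Notation Rn := ('rV[R]_n).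
Variables (c : R2n -> R) (K a b : R).
Local Notation pd := (partial_deriv c).
Hypothesis c_diff : forall z, differentiable c z.
Hypothesis pd_cont : forall j, continuous (pd j).
Hypothesis K_ge0 : 0 <= K.
Hypothesis pd_growth : forall z, \sum_j pd j z ^+ 2 <= K * (1 + sqn z).
Variables (Z : R -> {RV P >-> R2n}) (g h : R -> Rn -> Rn).
Hypothesis Z_sol : ocd_solution c [set` `[a, b]] Z g h.

Let mZ t : measurable_fun setT (Z t).
Proof. exact: measurable_funP. Qed.

Let Z2 t : a <= t <= b -> P.-integrable setT (fun w => (sqn (Z t w))%:E).
Proof.
move=> tab; apply: L2norm_integrable; last first.
  by apply: (ocd_moment2 Z_sol); rewrite /= in_itv.
by move=> j; exact: measurable_crd_comp.
Qed.

Lemma ocd_integrable_cost t : a <= t <= b ->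
  P.-integrable setT (fun w => (c (Z t w))%:E).
Proof.
by move=> tab; exact: (integrable_cost c_diff K_ge0 pd_growth (mZ t) (Z2 tab)).
Qed.

(** If slopes at [s] stayed above [e > 0] along times tending to [s], some of these
times would tend to [s] fast enough for [diff_quotient_expectation_cvg] to apply,
and [dissipation] says that the limit of the slopes is at most 0. *)
Lemma ocd_cost_nincr t : a <= t <= b ->
  fine (\int[P]_w (c (Z t w))%:E) <= fine (\int[P]_w (c (Z a w))%:E).
Proof.
move=> /andP[a_t tb]; pose F t := fine (\int[P]_w (c (Z t w))%:E).
apply: (@le_of_slope_le0 _ F) => // s e /andP[as_ st] e0.
have sab : a <= s <= b by rewrite as_ (le_trans st).
have sI : [set` `[a, b]] s by rewrite /= in_itv.
apply: contrapT => noS.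
have {}noS dl : 0 < dl -> exists u, [/\ a <= u <= b, u != s, `|u - s| < dl &
    e < (u - s)^-1 * (F u - F s)].
  move=> dl0; apply: contrapT => noU; apply: noS; exists dl => // u /andP[au ut] us usd.
  have uab : a <= u <= b by rewrite au (le_trans ut).
  by rewrite leNgt; apply/negP => eu; apply: noU; exists u.
pose V w := ocd_velocity c g h s (Z s w).
have close k : exists u, [/\ a <= u <= b, u != s, `|u - s| < k.+1%:R^-1,
    e < (u - s)^-1 * (F u - F s) &
    (\int[P]_w (sqn ((u - s)^-1 *: (Z u w - Z s w) - V w))%:E
       <= (1 / (2 ^ k.+1)%:R)%:E)%E].
  have ek0 : 0 < Num.sqrt (1 / (2 ^ k.+1)%:R) :> R.
    by rewrite sqrtr_gt0 divr_gt0// ltr0n expn_gt0.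
  have /(_ [set x | (x < (Num.sqrt (1 / (2 ^ k.+1)%:R))%:E)%E]) :=
    ocd_derivative Z_sol sI.
  case => [|dl /= dl0 dlP].
    exact: lt_nbhsl.
  have k0 : 0 < k.+1%:R^-1 :> R by rewrite invr_gt0.
  have md0 : 0 < Num.min dl k.+1%:R^-1 by rewrite lt_min dl0.
  have [u [uab us]] := noS _ md0; rewrite lt_min => /andP[usd usk] Fu.
  exists u; split => //.
  have uI : [set` `[a, b]] u by rewrite /= in_itv.
  have /L2norm_lt : (L2norm P (@enorm2 R n)
        (fun w => (u - s)^-1 *: (Z u w - Z s w) - V w)%R
      < (Num.sqrt (1 / (2 ^ k.+1)%:R))%:E)%E.
    by apply: (dlP u _ us uI); rewrite /ball_ /= distrC.
  by rewrite sqr_sqrtr// divr_ge0.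
have [u uP] := choice close.
pose r k := u k - s.
have rcv : r @ \oo --> 0.
  apply/norm_cvg0P.
  apply: (@squeeze_cvgr _ _ _ _ (fun=> 0) (fun k => k.+1%:R^-1)).
  - by apply: nearW => k; rewrite normr_ge0/=; have [_ _ /ltW] := uP k.
  - exact: cvg_cst.
  - exact: cvg_harmonic.
have mV j : measurable_fun setT (fun w => crd j (V w)).
  have := measurable_velocity (ocd_condx Z_sol sI) (ocd_condy Z_sol sI) j.
  by move=> mv; exact: (measurableT_comp mv).
have r0 k : r k != 0 by rewrite subr_eq0; have [] := uP k.
have r1 k : `|r k| <= 1.
  have [_ _ /ltW rk _ _] := uP k; apply: (le_trans rk).
  by rewrite invf_le1// ler1n.
(* The velocity differs from one difference quotient, which is square-integrable
   because the state is, by a square-integrable error. *)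
have iV : P.-integrable setT (fun w => (sqn (V w))%:E).
  have := uP 0%N; set v := u 0%N => -[vab vs _ _ QV].
  pose Q w := (v - s)^-1 *: (Z v w - Z s w).
  have mQ j : measurable_fun setT (fun w => crd j (Q w)).
    rewrite /Q; under eq_fun do rewrite crdZ crdD crdN.
    apply: measurable_funM => //.
    by apply: measurable_funB; exact: measurable_crd_comp.
  have mQV : measurable_fun setT (fun w => sqn (Q w - V w)).
    apply: measurable_sqn => j; under eq_fun do rewrite crdD crdN.
    exact: measurable_funB.
  have iQV : P.-integrable setT (fun w => (sqn (Q w - V w))%:E).
    apply/integrableP; split; first exact/measurable_EFinP.
    under eq_integral do rewrite gee0_abs ?lee_fin ?sqn_ge0//.
    by apply: (le_lt_trans QV); exact: ltry.
  pose D w := 4 * (v - s)^-1 ^+ 2 * (sqn (Z v w) + sqn (Z s w)) + 2 * sqn (Q w - V w).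
  have iD : P.-integrable setT (fun w => (D w)%:E).
    rewrite /D; under eq_fun do rewrite EFinD EFinM (EFinM 2) EFinD.
    apply: integrableD => //; apply: integrableZl => //.
    by apply: integrableD => //; exact: Z2.
  apply: le_integrable iD => //.
    by apply/measurable_EFinP; exact: measurable_sqn.
  move=> w _ /=; rewrite lee_fin ger0_norm ?sqn_ge0//.
  apply: le_trans (ler_norm _).
  have -> : V w = Q w + - (Q w - V w) by rewrite opprB addrC subrK.
  apply: (le_trans (sqnD_le _ _)); rewrite sqnN.
  rewrite /D lerD2r /Q sqnZ.
  have := sqnD_le (Z v w) (- Z s w); rewrite sqnN.
  move=> /(ler_wpM2l (sqr_ge0 (v - s)^-1)); lra.
have [iVZ H] := @diff_quotient_expectation_cvg _ _ _ _ P c K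
  c_diff pd_cont K_ge0 pd_growth (Z s) V (fun k => Z (u k)) r (mZ s) mV (fun k => mZ (u k)) (Z2 sab) iV r0 r1 rcv
  (fun k => let: And5 _ _ _ _ q := uP k in q).
have diss : (\int[P]_w (\sum_j crd j (V w) * pd j (Z s w))%:E <= 0)%E.
  pose VV z := ocd_velocity c g h s z.
  have msqn : measurable_fun setT (fun z : R2n => (sqn z)%:E).
    by apply/measurable_EFinP; apply: measurable_sqn => j; exact: measurable_crd.
  have mVV := measurable_velocity (ocd_condx Z_sol sI) (ocd_condy Z_sol sI).
  have msqV : measurable_fun setT (fun z => (sqn (VV z))%:E).
    by apply/measurable_EFinP; exact: measurable_sqn.
  have := dissipation (ocd_condx Z_sol sI) (ocd_condy Z_sol sI) pd_growth
    (integrable_pushforward (mZ s) msqn (Z2 sab) measurableT)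
    (integrable_pushforward (mZ s) msqV iV measurableT).
  rewrite integral_distribution//.
  apply/measurable_EFinP; apply: measurable_sum => j; apply: measurable_funM => //.
  exact: continuous_measurable_rV2.
have iC v : a <= v <= b -> (\int[P]_w (c (Z v w))%:E = (F v)%:E)%E.
  by move=> vab; rewrite fineK// integrable_fin_num//; exact: ocd_integrable_cost.
have : (e%:E <= \int[P]_w (\sum_j crd j (V w) * pd j (Z s w))%:E)%E.
  apply: cvge_ge H; apply: nearW => k.
  have [uab _ _ Fu _] := uP k.
  under eq_integral do rewrite EFinM EFinB.
  rewrite integralZl//; last by apply: integrableB => //; exact: ocd_integrable_cost.
  rewrite integralB//; [|exact: ocd_integrable_cost..].
  by rewrite !iC// -EFinB -EFinM lee_fin ltW.
by move=> /le_trans/(_ diss); rewrite lee_fin leNgt e0.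
Qed.

End energy.

(** * Instability of sub-optimal laws *)

(** The mixture is only a set function; it is represented by the measure
[(1 - eps) p + eps q], against which the integral splits. *)
Lemma cost_mixture (R : realType) (n : nat)
    (c : 'rV[R]_n * 'rV[R]_n -> R) (eps : R)
    (p q r : probability ('rV[R]_n * 'rV[R]_n)%type R) :
  (forall z, 0 <= c z) -> measurable_fun setT c -> 0 <= eps -> eps <= 1 ->
  same_law r (mixture eps p q) ->
  cost c r = ((1 - eps)%:E * cost c p + eps%:E * cost c q)%E.
Proof.
move=> c0 mc eps0 eps1 rE.
have e10 : 0 <= 1 - eps by lra.
have mEc : measurable_fun setT (EFin \o c) by exact/measurable_EFinP.
rewrite /cost (@eq_measure_integral _ _ _ setT
  (measure_add (mscale (NngNum e10) p) (mscale (NngNum eps0) q))); last first.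
  move=> A mA _; apply: (etrans (rE A mA)).
  by rewrite /measure_add /= /msum 2!big_ord_recl /= big_ord0 adde0.
rewrite ge0_integral_measure_add//; last by move=> z _; rewrite lee_fin.
by rewrite !ge0_integral_mscale//; move=> z _; rewrite lee_fin.
Qed.

(** The constant 3 comes from [(1 + x + y) ^ 2 <= 3 (1 + x ^ 2 + y ^ 2)]. *)
Lemma sqr_growth (R : realDomainType) (u v x y C : R) : 0 <= u -> 0 <= v ->
  u + v <= C * (1 + x + y) ->
  u ^+ 2 + v ^+ 2 <= 3 * C ^+ 2 * (1 + (x ^+ 2 + y ^+ 2)).
Proof.
move=> u0 v0 uv.
have : (u + v) ^+ 2 <= (C * (1 + x + y)) ^+ 2.
  by rewrite lerXn2r// nnegrE ?(le_trans _ uv)// addr_ge0.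
have sq3 : (1 + x + y) ^+ 2 <= 3 * (1 + (x ^+ 2 + y ^+ 2)).
  have := sqr_ge0 (x - 1); have := sqr_ge0 (y - 1); have := sqr_ge0 (x - y).
  by nra.
have := ler_wpM2l (sqr_ge0 C) sq3; rewrite exprMn.
have := mulr_ge0 u0 v0.
move: (C ^+ 2) => C2; lra.
Qed.

Lemma partial_deriv_growth (R : realType) (n : nat)
    (c : 'rV[R]_n * 'rV[R]_n -> R) (C : R) :
  (forall z, enorm (grad_x c z) + enorm (grad_y c z)
     <= C * (1 + enorm z.1 + enorm z.2)) ->
  forall z, \sum_j partial_deriv c j z ^+ 2 <= 3 * C ^+ 2 * (1 + sqn z).
Proof.
move=> growth z.
have -> : sqn z = enorm z.1 ^+ 2 + enorm z.2 ^+ 2.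
  by rewrite /sqn big_sumType !enorm_sq.
apply: le_trans (sqr_growth (sqrtr_ge0 _) (sqrtr_ge0 _) (growth z)).
rewrite big_sumType /=.
apply: lerD; rewrite [leRHS]enorm_sq; apply: ler_sum => i _.
  by rewrite [grad_x _ _ _ _]mxE.
by rewrite [grad_y _ _ _ _]mxE.
Qed.

Theorem proposition2p3 (R : realType) (n : nat)
    (c : 'rV[R]_n * 'rV[R]_n -> R)
    (c_ge0 : forall z, 0 <= c z) (c_smooth : smooth c)
    (mu nu : probability 'rV[R]_n R)
    (mu2 : finite_moment2 mu) (nu2 : finite_moment2 nu)
    (pi_opt : probability ('rV[R]_n * 'rV[R]_n)%type R)
    (pi_optP : optimal_coupling c mu nu pi_opt)
    (pi : probability ('rV[R]_n * 'rV[R]_n)%type R)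
    (piP : coupling mu nu pi)
    (T : R) (T_gt0 : 0 < T)
    (d : measure_display) (Omega : measurableType d) (P : probability Omega R)
    (Z : R -> {RV P >-> ('rV[R]_n * 'rV[R]_n)%type})
    (g h : R -> 'rV[R]_n -> 'rV[R]_n)
    (Z_sol : ocd_solution c [set` `[0, T]] Z g h)
    (Z_init : same_law (distribution P (Z 0)) pi)
    (Z_reg : regularity mu nu c [set` `[0, T]]
               (fun t => distribution P (Z t)) g h)
    (Z_subopt : suboptimal_coupling c mu nu pi_opt (distribution P (Z T)))
    (eps : R) (eps_gt0 : 0 < eps) (eps_lt1 : eps < 1)
    (d' : measure_display) (Omega' : measurableType d')
    (P' : probability Omega' R)
    (S : R) (T_lt_S : T < S)
    (Z' : R -> {RV P' >-> ('rV[R]_n * 'rV[R]_n)%type})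
    (g' h' : R -> 'rV[R]_n -> 'rV[R]_n)
    (Z'_sol : ocd_solution c [set` `[T, S]] Z' g' h')
    (Z'_init : same_law (distribution P' (Z' T))
                 (mixture eps (distribution P (Z T)) pi_opt)) :
  forall t : R, T < t <= S ->
    ~ same_law (distribution P' (Z' t)) (distribution P (Z T)).
Proof.
have [[c_diff c_C1] [C growth]] := reg_cost Z_reg.
have pd_cont j : continuous (partial_deriv c j) by exact: c_C1.
have pd_growth := partial_deriv_growth growth.
have K0 : 0 <= 3 * C ^+ 2 by rewrite mulr_ge0 ?sqr_ge0.
have mc : measurable_fun setT c.
  by apply: continuous_measurable_rV2 => z; exact: differentiable_continuous.
have mEc : measurable_fun setT (EFin \o c) by exact/measurable_EFinP.
have costE d1 (O : measurableType d1) (Q : probability O R)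
    (X : {RV Q >-> ('rV[R]_n * 'rV[R]_n)%type}) :
    cost c (distribution Q X) = (\int[Q]_w (c (X w))%:E)%E.
  by rewrite /cost ge0_integral_distribution// => z; rewrite lee_fin.
move=> t /andP[Tt tS] tlaw.
have TT : 0 <= T <= T by rewrite lexx ltW.
have tin : T <= t <= S by rewrite tS ltW.
have cost_t : cost c (distribution P' (Z' t)) = cost c (distribution P (Z T)).
  by apply: eq_measure_integral => A mA _; exact: tlaw.
have := cost_mixture c_ge0 mc (ltW eps_gt0) (ltW eps_lt1) Z'_init.
have := ocd_cost_nincr c_diff pd_cont K0 pd_growth Z'_sol tin.
rewrite -!costE cost_t.
have xfin : cost c (distribution P (Z T)) \is a fin_num.
  rewrite costE integrable_fin_num//.
  exact: (ocd_integrable_cost c_diff K0 pd_growth Z_sol).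
have [_ lt_cost] := Z_subopt.
have y0 : (0 <= cost c pi_opt)%E by apply: integral_ge0 => z _; rewrite lee_fin.
move: xfin lt_cost y0; rewrite /=.
case: (cost c (distribution P (Z T))) => [x| |]// _.
case: (cost c pi_opt) => [y| |]//; rewrite lte_fin => yx _ le_x mixE.
move: le_x; rewrite mixE -!EFinM -EFinD /=.
by move: eps_gt0 yx; nra.
Qed.
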